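(* Let $N, M, M' \in \mathbb{N}$, let $T:\mathbb{R}^N\to\mathbb{R}^M$ and $\mathcal{Q}:\mathbb{R}^N\to\mathbb{R}^{M'}$ be linear operators, let $g\in\mathbb{R}^M$, and let $r>0$. Then for every real parameter $p\ge 1$ the constrained minimization problem $$\text{minimize}\quad \mathcal{J}^p_r(u)=\|Tu-g\|_{\ell_2^M}^2+\sum_{i=1}^N\min\{|u_i|^p,r^p\}\qquad\text{subject to}\quad \mathcal{Q}u=0,\ u\in\mathbb{R}^N,$$ has a minimizer, i.e. there exists $u^*\in\mathbb{R}^N$ with $\mathcal{Q}u^*=0$ and $\mathcal{J}^p_r(u^* )\le\mathcal{J}^p_r(u)$ for all $u\in\mathbb{R}^N$ with $\mathcal{Q}u=0$.
   Context: $\|\cdot\|_{\ell_2^M}$ denotes the Euclidean norm on $\mathbb{R}^M$. *)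

(* Defs.v *)
From mathcomp Require Import all_boot all_order all_algebra.
From mathcomp Require Import reals exp.

Set Implicit Arguments.
Unset Strict Implicit.
Unset Printing Implicit Defensive.

Import Order.TTheory GRing.Theory Num.Theory.
Local Open Scope ring_scope.

(* The norm `|x| that MathComp-Analysis puts on matrices is the sup norm,
   hence an explicit Euclidean norm. *)
Definition l2norm (R : realType) (M : nat) (x : 'cV[R]_M) : R :=
  Num.sqrt (\sum_(j < M) x j 0 ^+ 2).

Definition Jpr (R : realType) (N M : nat)
    (T : {linear 'cV[R]_N -> 'cV[R]_M}) (g : 'cV[R]_M) (r p : R)
    (u : 'cV[R]_N) : R :=
  l2norm (T u - g) ^+ 2 + \sum_(i < N) Num.min (`|u i 0| `^ p) (r `^ p).

(* Main.v *)
Require Import Defs.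
From mathcomp Require Import all_boot all_order all_algebra.
From mathcomp Require Import reals exp.
From mathcomp Require Import boolp classical_sets topology normedtype derive.

Set Implicit Arguments.
Unset Strict Implicit.
Unset Printing Implicit Defensive.

Import Order.TTheory GRing.Theory Num.Theory.
Import numFieldNormedType.Exports.
Local Open Scope classical_set_scope.
Local Open Scope ring_scope.

(** For a set [S] of indices replace every summand [min(|u_i|^p, r^p)] by [r^p]
when [i] is in [S] and by [|u_i|^p] otherwise.  The functional [J] is the
pointwise minimum of the finitely many functionals [F_S] so obtained, hence it
suffices to minimize each [F_S] on [ker Q].  Up to a constant, [F_S] is a
continuous coercive function of the vector made of [T u] and of the
coordinates of [u] outside [S]; this vector ranges over a linear subspace as [u]
ranges over [ker Q], and a subspace of a finite-dimensional space is closed, so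
the minimum is attained. *)

Lemma continuous_norm_powR (R : realType) (p : R) :
  1 <= p -> continuous (fun x : R => `|x| `^ p).
Proof.
move=> p1 x; have p0 : p != 0 by rewrite gt_eqF// (lt_le_trans ltr01).
have [->|x0] := eqVneq x 0.
  rewrite /continuous_at normr0 powR0//.
  apply/cvgr0Pnorm_lt => e e0; exists (Num.min 1 e).
    by rewrite /= lt_min ltr01.
  move=> y; rewrite /= sub0r normrN lt_min => /andP[y1 ye].
  rewrite ger0_norm ?powR_ge0//.
  have [->|y0] := eqVneq y 0.
    by rewrite normr0 powR0.
  by apply: le_lt_trans ye; rewrite ge1r_powR// normr_gt0 y0 ltW.
apply: (@continuous_comp _ _ _ (fun y : R => `|y|) (fun y : R => y `^ p)).
  exact: norm_continuous.
apply: differentiable_continuous; apply/derivable1_diffP.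
by apply: derivable_powR; rewrite in_itv/= normr_gt0 x0.
Qed.

(** The row space of [W] is the kernel of [cokermx W], thus a finite intersection of zero sets of
    continuous functions. *)
Lemma closed_submx (R : realType) m n (W : 'M[R]_(m, n)) :
  closed [set y : 'rV[R]_n | (y <= W)%MS].
Proof.
pose f j (y : 'rV[R]_n) := (y *m cokermx W) 0 j.
have -> : [set y : 'rV[R]_n | (y <= W)%MS] =
    \bigcap_(j in setT) (f j @^-1` [set x | x = 0]).
  apply/seteqP; split => y /=; rewrite submxE.
    by move=> /eqP yW j _; rewrite /= /f yW mxE.
  by move=> yW; apply/eqP/rowP => j; rewrite [LHS](yW j) // mxE.
apply: closed_bigI => j _; apply: closed_comp; last exact: closed_eq.
move=> y _; rewrite /f.
under eq_fun do rewrite mxE.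
apply: continuous_big => [|i _]; first exact: add_continuous.
move=> z; apply: (@cvgM _ _ (nbhs z)); last exact: cvg_cst.
exact: coord_continuous.
Qed.

(* Only the sublevel set of [f 0] has to be bounded: the minimum is sought in
   its intersection with the subspace, which contains [0]. *)
Lemma submx_min_exists (R : realType) m n (W : 'M[R]_(m, n))
    (f : 'rV[R]_n -> R) (b : R) :
  continuous f -> (forall y, f y <= f 0 -> forall j, `|y 0 j| <= b) ->
  exists2 y0, (y0 <= W)%MS & forall y, (y <= W)%MS -> f y0 <= f y.
Proof.
move=> cf fb.
pose K := [set y : 'rV[R]_n | (y <= W)%MS] `&` (f @^-1` [set x | x <= f 0]).
have K0 : K 0 by split; rewrite /= ?sub0mx.
have cK : compact K.
  apply: bounded_closed_compact; last first.
    apply: closedI; first exact: closed_submx.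
    by apply: closed_comp => [x _|]; [exact: cf|exact: closed_le].
  exists `|b|; split; first exact: num_real.
  move=> c bc y [_ /fb yb] /=; rewrite /Num.Def.normr /= mx_normrE.
  apply: bigmax_le => [|[i j] _]; first exact: le_trans (ltW bc).
  by rewrite (ord1 i) (le_trans (yb j))// (le_trans (ler_norm b))// ltW.
have [||y0] := @compact_EVT_min _ _ f K _ cK; first by exists 0.
  exact: continuous_subspaceT.
rewrite inE => -[/= y0W fy0] y0min; exists y0 => // y yW.
have [yf|/ltW yf] := leP (f y) (f 0); last exact: le_trans fy0 yf.
by apply: y0min; rewrite inE.
Qed.

(** The image of the kernel under [A] is the row space of [kermx B *m A], and a minimizer there
    pulls back to the kernel. Compactness is used only in the image: sublevel sets in [u] may be
    unbounded. *)
Lemma ker_min_exists (R : realType) m n k (B : 'M[R]_(m, k)) (A : 'M[R]_(m, n))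
    (f : 'rV[R]_n -> R) (b : R) :
  continuous f -> (forall y, f y <= f 0 -> forall j, `|y 0 j| <= b) ->
  exists2 u0 : 'rV_m, u0 *m B = 0 &
    forall u : 'rV_m, u *m B = 0 -> f (u0 *m A) <= f (u *m A).
Proof.
move=> cf fb.
have [_ /submxP[w ->] wmin] := submx_min_exists (kermx B *m A) cf fb.
exists (w *m kermx B); first by rewrite -mulmxA mulmx_ker mulmx0.
move=> u uB; rewrite -mulmxA; apply: wmin; apply: submxMr.
by apply/sub_kermxP.
Qed.

Lemma linear_cV_mulmx (R : realType) m n (f : {linear 'cV[R]_m -> 'cV[R]_n}) :
  exists A : 'M[R]_(m, n), forall u, f u = (u^T *m A)^T.
Proof.
exists (lin1_mx (trmx \o f \o trmx)) => u.
by rewrite mul_rV_lin1 /= !trmxK.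
Qed.

Definition fidelity_penalty (R : realType) (N M : nat) (g : 'cV[R]_M) (p : R)
    (y : 'rV[R]_(M + N)) : R :=
  \sum_(j < M) (y 0 (lshift N j) - g j 0) ^+ 2 +
  \sum_(i < N) `|y 0 (rshift M i)| `^ p.

Lemma continuous_fidelity_penalty (R : realType) (N M : nat) (g : 'cV[R]_M)
    (p : R) :
  1 <= p -> continuous (@fidelity_penalty R N M g p).
Proof.
move=> p1 y; rewrite /fidelity_penalty.
apply: (@cvgD _ _ _ (nbhs y)).
  apply: (@continuous_big _ _ _ _ _ (@add_continuous R^o)) => j _ z.
  pose h (x : 'rV[R]_(M + N)) := x 0 (lshift N j) - g j 0.
  suff hz : h x @[x --> z] --> h z by exact: (cvgM hz hz).
  by apply: (@cvgB _ _ _ (nbhs z)); [exact: coord_continuous|exact: cvg_cst].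
apply: (@continuous_big _ _ _ _ _ (@add_continuous R^o)) => i _ z.
apply: (@continuous_comp _ _ _ (fun y : 'rV_(M + N) => y 0 (rshift M i))
  (fun x : R => `|x| `^ p)); first exact: coord_continuous.
exact: continuous_norm_powR.
Qed.

Lemma fidelity_penalty_coercive (R : realType) (N M : nat) (g : 'cV[R]_M)
    (p c : R) (y : 'rV[R]_(M + N)) (k : 'I_(M + N)) :
  1 <= p -> fidelity_penalty g p y <= c ->
  `|y 0 k| <= 1 + c + \sum_(j < M) `|g j 0|.
Proof.
move=> p1 yc.
have sq0 : 0 <= \sum_(j < M) (y 0 (lshift N j) - g j 0) ^+ 2.
  by apply: sumr_ge0 => j _; exact: sqr_ge0.
have po0 : 0 <= \sum_(i < N) `|y 0 (rshift M i)| `^ p.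
  by apply: sumr_ge0 => i _; exact: powR_ge0.
have g0 : 0 <= \sum_(j < M) `|g j 0| by exact: sumr_ge0.
have c0 : 0 <= c by apply: le_trans yc; exact: addr_ge0.
rewrite -[k]splitK; case: (split k) => [j|i] /=.
  have gj : `|g j 0| <= \sum_(j < M) `|g j 0|.
    by rewrite (bigD1 j)//= lerDl sumr_ge0.
  have dj : (y 0 (lshift N j) - g j 0) ^+ 2 <= c.
    apply: le_trans yc; rewrite /fidelity_penalty (bigD1 j)//= -addrA lerDl.
    by rewrite addr_ge0// sumr_ge0// => l _; exact: sqr_ge0.
  rewrite -[y 0 _](subrK (g j 0)) (le_trans (ler_normD _ _))// lerD//.
  have [d1|/ltW d1] := leP `|y 0 (lshift N j) - g j 0| 1.
    by rewrite (le_trans d1)// lerDl.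
  rewrite -real_normK ?num_real// in dj.
  by rewrite (le_trans (ler_eXnr (isT : (0 < 2)%N) d1))// (le_trans dj)// lerDr.
have [y1|/ltW y1] := leP `|y 0 (rshift M i)| 1.
  by rewrite (le_trans y1)// -addrA lerDl addr_ge0.
rewrite (le_trans (le1r_powR y1 p1))// -addrA addrCA.
apply: (@le_trans _ _ c); last by rewrite lerDl addr_ge0.
apply: le_trans yc; rewrite /fidelity_penalty (bigD1 i)//= addrCA lerDl.
by rewrite addr_ge0// sumr_ge0// => l _; exact: powR_ge0.
Qed.

(** Coordinates in [S] are zeroed rather than deleted, so that the dimension does not depend on
    [S]. *)
Definition uncapped_coords (R : realType) (N : nat) (S : {set 'I_N}) : 'M[R]_N :=
  diag_mx (\row_i (i \notin S)%:R).

Lemma fidelity_penalty_row_mx (R : realType) (N M : nat)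
    (T : {linear 'cV[R]_N -> 'cV[R]_M}) (A : 'M[R]_(N, M)) (g : 'cV[R]_M)
    (p : R) (u : 'cV[R]_N) (S : {set 'I_N}) :
  p != 0 -> T u = (u^T *m A)^T ->
  fidelity_penalty g p (u^T *m row_mx A (uncapped_coords R S)) =
  l2norm (T u - g) ^+ 2 + \sum_(i | i \notin S) `|u i 0| `^ p.
Proof.
move=> p0 Tu; rewrite /l2norm sqr_sqrtr; last first.
  by apply: sumr_ge0 => j _; exact: sqr_ge0.
rewrite /fidelity_penalty mul_mx_row; congr (_ + _).
  by apply: eq_bigr => j _; rewrite row_mxEl Tu !mxE.
rewrite [RHS]big_mkcond; apply: eq_bigr => i _.
rewrite row_mxEr mul_mx_diag !mxE.
by case: (i \in S); rewrite ?mulr0 ?normr0 ?powR0// mulr1.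
Qed.

Theorem theorem2p2 (R : realType) (N M M' : nat)
    (T : {linear 'cV[R]_N -> 'cV[R]_M}) (Q : {linear 'cV[R]_N -> 'cV[R]_M'})
    (g : 'cV[R]_M) (r : R) (hr : 0 < r) (p : R) (hp : 1 <= p) :
  exists ustar : 'cV[R]_N,
    Q ustar = 0 /\
    (forall u : 'cV[R]_N, Q u = 0 -> Jpr T g r p ustar <= Jpr T g r p u).
Proof.
have p0 : p != 0 by rewrite gt_eqF// (lt_le_trans ltr01).
have [A TA] := linear_cV_mulmx T.
have [B QB] := linear_cV_mulmx Q.
have QBE u : Q u = 0 <-> u^T *m B = 0.
  rewrite QB; split=> [/(congr1 trmx)|->]; last exact: trmx0.
  by rewrite trmxK trmx0.
pose F (S : {set 'I_N}) (u : 'cV[R]_N) :=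
  l2norm (T u - g) ^+ 2 + \sum_(i | i \notin S) `|u i 0| `^ p +
  \sum_(i in S) r `^ p.
have FJ S u : Jpr T g r p u <= F S u.
  rewrite /Jpr /F -addrA lerD2l (bigID (mem S))/= addrC.
  by apply: lerD; apply: ler_sum => i _; rewrite ge_min lexx ?orbT.
(* Equality holds for the set of indices where the cap is strictly the smaller term. *)
have JF u : Jpr T g r p u = F [set i | r `^ p < `|u i 0| `^ p]%SET u.
  set S := finset _; rewrite /Jpr /F -addrA; congr (_ + _).
  rewrite (bigID (mem S))/= addrC; congr (_ + _); apply: eq_bigr => i.
    by rewrite inE -leNgt => /min_l.
  by rewrite inE => /ltW/min_r.
have Fmin S : exists u0, Q u0 = 0 /\ forall u, Q u = 0 -> F S u0 <= F S u.
  have [w wB wmin] := ker_min_exists B (row_mx A (uncapped_coords R S))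
    (@continuous_fidelity_penalty R N M g p hp)
    (fun y y0 j => fidelity_penalty_coercive j hp y0).
  exists w^T; split; first by apply/QBE; rewrite trmxK.
  move=> u /QBE/wmin.
  rewrite -{1}[w]trmxK !(fidelity_penalty_row_mx _ _ p0 (TA _)).
  by rewrite lerD2r.
have [ubar ubarP] := choice Fmin.
have [S _ Smin] := @arg_minP _ _ _ (finset.set0 : {set 'I_N}) xpredT
  (fun S => F S (ubar S)) isT.
exists (ubar S); split=> [|u Qu]; first by have [] := ubarP S.
(* With [S'] the capped set of [u], the chain is [J (ubar S) <= F S (ubar S) <= F S' (ubar S') <= F
   S' u = J u]. *)
rewrite (le_trans (FJ S _))// JF; set S' := finset _.
by rewrite (le_trans (Smin S' isT))//; apply: (ubarP S').2.
Qed.
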